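(* Among all probability distributions $\mathbf{p}=(p_0,p_1,p_2)$ on three colors with $p_0\ge p_1\ge p_2\ge 0$ and $p_0+p_1+p_2=1$, the maximum value of the discrepancy $D(\mathbf{p})$ is achieved, uniquely, at $$\mathbf{p}=\left(x_2,\frac{1-x_2}{2},\frac{1-x_2}{2}\right),$$ where $x_2$ is the root in $[0.5,0.6]$ of $$-5+42x-114x^2+168x^3-153x^4+54x^5=0 .$$ The maximum value is $D(\mathbf{p})=z/2$, where $z$ is the root in $(0,0.2)$ of $$32000+168192\,z-4557600\,z^2+14567472\,z^3-821583\,z^4+314928\,z^5=0 .$$
   Context: For a probability distribution $\mathbf{p}=(p_i)_i$ on a finite or countable set of colors, define two derived distributions on colors. Method 1: $\mathbb{P}(X=i)=p_i^2/f_2$ with $f_2=\sum_i p_i^2$ (the color of a pair of independent samples from $\mathbf{p}$, conditional on the two agreeing). Method 2: $Y$ is the first color to be seen twice when sampling independently from $\mathbf{p}$, one at a time; explicitly $$\mathbb{P}(Y=i)=p_i^2\sum_{k\ge 0}(k+1)!\sum_{J:\,|J|=k,\ i\notin J}\ \prod_{j\in J}p_j ,$$ the inner sum being over sets $J$ of $k$ distinct colors not containing $i$. The discrepancy of $\mathbf{p}$ is the total variation distance between these two laws: $$D(\mathbf{p})=\frac12\sum_i\big|\mathbb{P}(X=i)-\mathbb{P}(Y=i)\big|.$$ *)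

(* Defs.v *)
From mathcomp Require Import all_boot all_order all_algebra.
From mathcomp Require Import reals.

Set Implicit Arguments.
Unset Strict Implicit.
Unset Printing Implicit Defensive.

Import GRing.Theory Num.Theory.

Local Open Scope ring_scope.

Section Discrepancy.
Variables (R : realType) (T : finType).
Implicit Types (p : {ffun T -> R}) (i : T).

Definition is_distr p : Prop :=
  (forall i, 0 <= p i) /\ \sum_i p i = 1.

(* Law of the color of a pair of independent samples from p, conditional on
   the two agreeing. *)
Definition lawX p i : R := p i ^+ 2 / \sum_j p j ^+ 2.

(* Law of the first color to be seen twice: i is that color, first repeated at
   draw k + 2, when the first k + 1 draws are i and the k distinct colors of
   some J not containing i, in any of the (k + 1)! orders, and draw k + 2 is i
   again. A set J of colors without i has fewer than #|T| elements, so the sum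
   over all k >= 0 stops there. *)
Definition lawY p i : R :=
  p i ^+ 2 *
  \sum_(k < #|T|) (k.+1)`!%:R *
    \sum_(J : {set T} | (#|J| == k) && (i \notin J)) \prod_(j in J) p j.

Definition discrepancy p : R :=
  2^-1 * \sum_i `|lawX p i - lawY p i|.

End Discrepancy.

Section ThreeColors.
Variable R : realType.

Definition color0 : 'I_3 := @Ordinal 3 0 isT.
Definition color1 : 'I_3 := @Ordinal 3 1 isT.
Definition color2 : 'I_3 := @Ordinal 3 2 isT.

Definition triple (a b c : R) : {ffun 'I_3 -> R} :=
  [ffun i : 'I_3 => nth 0 [:: a; b; c] i].

Definition ordered_distr3 (p : {ffun 'I_3 -> R}) : Prop :=
  is_distr p /\ p color2 <= p color1 <= p color0.

Definition quintic_x (x : R) : R :=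
  - 5 + 42 * x - 114 * x ^+ 2 + 168 * x ^+ 3 - 153 * x ^+ 4 + 54 * x ^+ 5.

(* The coefficients are nat literals cast by %:R, because literals of this size
   read directly in ring_scope are expanded in unary and overflow the stack. *)
Definition quintic_z (z : R) : R :=
  32000%:R + 168192%:R * z - 4557600%:R * z ^+ 2 + 14567472%:R * z ^+ 3
    - 821583%:R * z ^+ 4 + 314928%:R * z ^+ 5.

End ThreeColors.

(* Main.v *)
Require Import Defs.
From mathcomp Require Import all_boot all_order all_algebra.
From mathcomp Require Import reals.
From mathcomp Require Import ring lra.

Import Order.TTheory GRing.Theory Num.Theory.

Local Open Scope ring_scope.

(** Write the probabilities as [a >= b >= c], let [f = a^2 + b^2 + c^2], and let
the gap at a color be the difference of its probabilities under the two laws.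
At the color of probability [a] it is [a^2 (1/f - 3 + 2 a - 6 b c)]. The three
gaps sum to 0, and their second factors are ordered like the probabilities
([gap_sign]), so the gap at the most likely color is nonnegative, the gap at
the least likely one is nonpositive, and the discrepancy is the larger of the
absolute values of these two ([discrepancy3]). The least likely color never
contributes as much as 1/12 ([gap_least]), which is less than the claimed
maximum [z / 2].

It remains to bound the gap at the color of probability [a], for any [a] in
[0, 1]. With [a] fixed, it is a convex function of [m = b c], which ranges over
the interval from 0 to [(1 - a)^2 / 4]; it is thus at most the larger of its
values at the ends: two colors ([m = 0]), where it stays below [z / 2], and two
equal minor colors. In the latter case the gap is [N(a) / (2 q(a))] with
[N(a) = a^2 (1 - a)^2 (3 a - 1) (5 - 3 a)] and [q(a) = 3 a^2 - 2 a + 1], and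
the numerator of the derivative of [N / q] is [2 a (1 - a)] times the quintic
in [x]. At the root [x] of that quintic, [z q(a) - N(a)] with
[z = N(x) / q(x)] has a double zero, and the quotient by [(a - x)^2] is
positive on [0, 1] ([slack_equal], [slack_quot_gt0]). All of this is written
without quotients, through the polynomial [slack], which is [2 f] times the
distance of the gap from [z / 2].

Modulo the quintic in [x], [z] is the polynomial [2 x^3 (2 - 9 (1 - x)^2)] of
[x]; the quintic in [z] evaluated there is a multiple of the quintic in [x]
([quintic_z_zmax]). *)

(** * The two laws on three colors *)

(** The sets of 0, 1 and 2 colors other than [i] give the three terms, with
    weights 1!, 2! and 3!. *)
Lemma lawY3 {R : realType} {T : finType} (p : {ffun T -> R}) {i j k : T} :
  #|T| = 3%N -> [set~ i] = [set j; k] -> j != k ->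
  lawY p i = p i ^+ 2 * (1 + 2 * (p j + p k) + 6 * (p j * p k)).
Proof.
move=> cardT iC jk; rewrite /lawY cardT; congr (_ * _).
have no_i (J : {set T}) : (i \notin J) = (J \subset [set j; k]).
  by rewrite -iC subsetC sub1set inE.
rewrite !big_ord_recl big_ord0 /= addr0 addrA; congr (_ + _ + _).
- rewrite (big_pred1 set0) ?big_set0 ?mulr1 // => J /=.
  by rewrite cards_eq0; case: eqP => //= ->; rewrite inE.
- rewrite big_mkcondr big_cards1; congr (_ * _).
  transitivity (\sum_(l in [set j; k]) p l).
    rewrite [RHS]big_mkcond /= -iC; apply: eq_bigr => l _.
    by rewrite !inE eq_sym big_set1.
  by rewrite big_setU1 ?inE //= big_set1.
- rewrite (big_pred1 [set j; k]) => [|J /=].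
    by rewrite big_setU1 ?inE //= big_set1.
  rewrite no_i eqEcard cards2 jk andbC.
  case: (boolP (J \subset _)) => //= /subset_leq_card.
  by rewrite cards2 jk => le2; rewrite eqn_leq le2.
Qed.

(** The difference of the two laws at the color of probability [a], the other
    two colors having probabilities [b] and [c]. *)
Definition gap {R : realType} (a b c : R) : R :=
  a ^+ 2 * ((a ^+ 2 + b ^+ 2 + c ^+ 2)^-1 - (3 - 2 * a + 6 * (b * c))).

Lemma sum_I3 {R : realType} (F : 'I_3 -> R) :
  \sum_i F i = F color0 + F color1 + F color2.
Proof.
rewrite !big_ord_recl big_ord0 addr0 addrA.
by congr (F _ + F _ + F _); apply: val_inj.
Qed.

Lemma gapE {R : realType} (p : {ffun 'I_3 -> R}) (i j k : 'I_3) :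
  is_distr p -> [set~ i] = [set j; k] -> i != j -> i != k -> j != k ->
  lawX p i - lawY p i = gap (p i) (p j) (p k).
Proof.
move=> [_ p1] iC ij ik jk.
have sumE (F : 'I_3 -> R) : \sum_l F l = F i + F j + F k.
  rewrite (bigD1 i) //= -addrA; congr (_ + _).
  transitivity (\sum_(l in [set j; k]) F l).
    by apply: eq_bigl => l; rewrite -iC !inE.
  by rewrite big_setU1 ?inE //= big_set1.
rewrite (lawY3 p (card_ord 3) iC jk) // /lawX /gap sumE.
have -> : p i = 1 - p j - p k by rewrite -p1 sumE; ring.
ring.
Qed.

Lemma sqsum_gt0 {R : realType} {a b c : R} :
  a + b + c = 1 -> 0 < a ^+ 2 + b ^+ 2 + c ^+ 2.
Proof.
move=> abc; have -> : c = 1 - a - b by rewrite -abc; ring.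
have := sqr_ge0 (a - 1 / 3); have := sqr_ge0 (b - 1 / 3).
have := sqr_ge0 (a + b - 2 / 3); lra.
Qed.

Lemma gap_sum0 {R : realType} {a b c : R} :
  a + b + c = 1 -> gap a b c + gap b a c + gap c a b = 0.
Proof.
move=> abc; have := sqsum_gt0 abc; set f := _ + c ^+ 2 => f0.
rewrite /gap (addrC (b ^+ 2) (a ^+ 2)).
have -> : c ^+ 2 + a ^+ 2 + b ^+ 2 = f by rewrite /f; ring.
rewrite -/f.
suff : f * f^-1 = 1 -> (a ^+ 2 * (f^-1 - (3 - 2 * a + 6 * (b * c))) +
  b ^+ 2 * (f^-1 - (3 - 2 * b + 6 * (a * c))) +
  c ^+ 2 * (f^-1 - (3 - 2 * c + 6 * (a * b)))) = 0.
  by apply; rewrite divff // gt_eqF.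
rewrite {1}/f => ff.
transitivity ((a ^+ 2 + b ^+ 2 + c ^+ 2) * f^-1 - 1); last by rewrite ff subrr.
have -> : a = 1 - b - c by rewrite -abc; ring.
ring.
Qed.

(** The second factors [u >= v >= w] of the gaps are ordered like the
    probabilities. As the weighted sum [a^2 u + b^2 v + c^2 w] is 0 and [a] is
    positive, [u < 0] would make it negative and [w > 0] would make it
    positive. *)
Lemma gap_sign {R : realType} {a b c : R} :
  0 <= a -> 0 <= b -> 0 <= c -> a + b + c = 1 -> c <= b -> b <= a ->
  0 <= gap a b c /\ gap c a b <= 0.
Proof.
move=> a0 b0 c0 abc cb ba; move: (gap_sum0 abc).
rewrite /gap (addrC (b ^+ 2) (a ^+ 2)).
set f := a ^+ 2 + _ + _.
have -> : c ^+ 2 + a ^+ 2 + b ^+ 2 = f by rewrite /f; ring.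
set u := f^-1 - _; set v := f^-1 - _; set w := f^-1 - _ => S0.
have vu : v <= u.
  have : b * c <= a * c by rewrite ler_wpM2r.
  rewrite /u /v; lra.
have wv : w <= v.
  have : a * c <= a * b by rewrite ler_wpM2l.
  rewrite /w /v; lra.
have a_gt0 : 0 < a ^+ 2 by rewrite exprn_gt0; lra.
have b2 := sqr_ge0 b; have c2 := sqr_ge0 c.
clearbody u v w; split.
- rewrite mulr_ge0 ?sqr_ge0 // leNgt; apply/negP => u0.
  have : a ^+ 2 * u < 0 by rewrite pmulr_rlt0.
  have : b ^+ 2 * v <= 0 by rewrite mulr_ge0_le0; lra.
  have : c ^+ 2 * w <= 0 by rewrite mulr_ge0_le0; lra.
  lra.
- rewrite mulr_ge0_le0 ?sqr_ge0 // leNgt; apply/negP => w0.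
  have : 0 < a ^+ 2 * u by rewrite mulr_gt0; lra.
  have : 0 <= b ^+ 2 * v by rewrite mulr_ge0; lra.
  have : 0 <= c ^+ 2 * w by rewrite mulr_ge0; lra.
  lra.
Qed.

(** Since [2 a b = (1 - c)^2 + c^2 - f], the opposite of the gap at [c] is
    [c^2 (6 - 8 c + 6 c^2 - (3 f + 1 / f))], and [3 f + 1 / f] is at least
    [2 sqrt 3 > 3.46]. That leaves a polynomial in [c], to be bounded on
    [0, 1/3]. *)
Lemma gap_least {R : realType} {a b c : R} :
  0 <= c -> a + b + c = 1 -> c <= b -> b <= a -> - gap c a b < 1 / 12.
Proof.
move=> c0 abc cb ba; have := sqsum_gt0 abc.
set f := _ + c ^+ 2 => f0; rewrite /gap.
have -> : c ^+ 2 + a ^+ 2 + b ^+ 2 = f by rewrite /f; ring.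
have fV : f * f^-1 = 1 by rewrite divff // gt_eqF.
have fV0 : 0 <= f^-1 by rewrite invr_ge0 ltW.
have -> : 6 * (a * b) = 3 * ((1 - c) ^+ 2 + c ^+ 2 - f).
  by have -> : 1 - c = a + b; [rewrite -abc | rewrite /f]; ring.
have amgm : 346 / 100 <= 3 * f + f^-1.
  have h : 0 <= 3 * f ^+ 2 - 346 / 100 * f + 1.
    by have := sqr_ge0 (f - 173 / 300); lra.
  have := mulr_ge0 h fV0.
  have -> : (3 * f ^+ 2 - 346 / 100 * f + 1) * f^-1 =
     3 * f * (f * f^-1) - 346 / 100 * (f * f^-1) + f^-1 by ring.
  rewrite fV; lra.
have c13 : 0 <= 1 / 3 - c by lra.
have c2 := sqr_ge0 c.
have := mulr_ge0 c2 (_ : 0 <= 3 * f + f^-1 - 346 / 100).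
rewrite subr_ge0 => /(_ amgm).
have := mulr_ge0 (exprn_ge0 3 c0) c13.
(* The remaining polynomial c^2 (2.54 - 8 c + 6 c^2) is at most
   c^2 (2.54 - 6 c) on [0, 1/3], which is largest near c = 28/100. *)
have := mulr_ge0 c0 (sqr_ge0 (c - 28 / 100)).
have := sqr_ge0 (c - 28 / 100).
lra.
Qed.

(** The gaps sum to 0, so half the sum of their absolute values is the sum of
    the positive ones and also minus the sum of the negative ones. One of the
    two sums has a single term, at an extreme color, according to the sign of
    the gap at [color1]. *)
Lemma discrepancy3 {R : realType} (p : {ffun 'I_3 -> R}) :
  ordered_distr3 p ->
  discrepancy p = Num.max (gap (p color0) (p color1) (p color2))
                          (- gap (p color2) (p color0) (p color1)).
Proof.
move=> [[p0 p1] /andP[p21 p10]]; have p012 := p1; rewrite sum_I3 in p012.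
rewrite /discrepancy sum_I3.
rewrite (@gapE _ _ color0 color1 color2) //; last first.
  by apply/setP=> l; rewrite !inE; case: l => [[|[|[|?]]]] ?.
rewrite (@gapE _ _ color1 color0 color2) //; last first.
  by apply/setP=> l; rewrite !inE; case: l => [[|[|[|?]]]] ?.
rewrite (@gapE _ _ color2 color0 color1) //; last first.
  by apply/setP=> l; rewrite !inE; case: l => [[|[|[|?]]]] ?.
have [g0 g2] := gap_sign (p0 color0) (p0 color1) (p0 color2) p012 p21 p10.
have := gap_sum0 p012.
move: (gap (p color0) _ _) (gap (p color1) _ _) (gap (p color2) _ _) g0 g2.
move=> x y w g0 g2 S.
rewrite (ger0_norm g0) (ler0_norm g2).
case: (lerP 0 y) => y0.
- by rewrite (ger0_norm y0) max_r; lra.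
- by rewrite (ltr0_norm y0) max_l; lra.
Qed.

(** * The critical point *)

(** At [1/2 + u] the quintic is
    [5/8 - 45/8 u - 24 u^2 - 3 u^3 - 18 u^4 + 54 u^5], where for [u <= 1/10]
    the decrease of the quartic term outweighs the increase of the last one. *)
Lemma quintic_x_decr {R : realType} {x y : R} :
  1 / 2 <= x -> x < y -> y <= 3 / 5 -> quintic_x y < quintic_x x.
Proof.
move=> x_ge xy y_le.
have -> : x = 1 / 2 + (x - 1 / 2) by ring.
have -> : y = 1 / 2 + (y - 1 / 2) by ring.
have u0 : 0 <= x - 1 / 2 by lra.
have uv : x - 1 / 2 < y - 1 / 2 by lra.
have v1 : y - 1 / 2 <= 1 / 10 by lra.
move: (x - 1 / 2) (y - 1 / 2) u0 uv v1 => u v u0 uv v1.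
have v0 : 0 <= v by lra.
rewrite -subr_gt0.
have -> : quintic_x (1 / 2 + u) - quintic_x (1 / 2 + v) =
    (v - u) * (45 / 8 + 24 * (u + v) + 3 * (u ^+ 2 + u * v + v ^+ 2)
               + 18 * (u ^+ 3 + u ^+ 2 * v + u * v ^+ 2 + v ^+ 3)
               - 54 * (u ^+ 4 + u ^+ 3 * v + u ^+ 2 * v ^+ 2 + u * v ^+ 3
                       + v ^+ 4)).
  by rewrite /quintic_x; field.
apply: mulr_gt0; first by lra.
have S3 : 0 <= u ^+ 3 + u ^+ 2 * v + u * v ^+ 2 + v ^+ 3.
  by rewrite !addr_ge0 ?mulr_ge0 ?exprn_ge0.
have S2 : 0 <= u ^+ 2 + u * v + v ^+ 2.
  by rewrite !addr_ge0 ?mulr_ge0 ?exprn_ge0.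
have vS : 0 <= v * (u ^+ 3 + u ^+ 2 * v + u * v ^+ 2).
  by rewrite mulr_ge0 // !addr_ge0 ?mulr_ge0 ?exprn_ge0.
have uv5 : 0 <= 1 / 5 - (u + v) by lra.
have := mulr_ge0 S3 uv5.
lra.
Qed.

(** The root is near 0.58201; the narrow interval serves the later numerical
    bounds. *)
Lemma quintic_x_root (R : realType) :
  exists2 x : R, 32 / 55 <= x <= 7 / 12 & quintic_x x = 0.
Proof.
pose P : {poly R} := 5%:P - 42 *: 'X + 114 *: 'X^2 - 168 *: 'X^3
  + 153 *: 'X^4 - 54 *: 'X^5.
have PE x : P.[x] = - quintic_x x.
  by rewrite /P /quintic_x !hornerE; ring.
have le_ends : 32 / 55 <= 7 / 12 :> R by lra.
have sign : P.[32 / 55] <= 0 <= P.[7 / 12].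
  by rewrite !PE /quintic_x; apply/andP; split; lra.
have [x x_in] := poly_ivt le_ends sign.
rewrite /root PE oppr_eq0 => /eqP Qx; exists x => //.
Qed.

(** With [N] and [q] as above, [N(x) = q(x) * zmax x + x^2 * quintic_x x]: at a
    root of the quintic [zmax x] is twice the gap at
    [(x, (1 - x)/2, (1 - x)/2)]. *)
Definition zmax {R : realType} (x : R) : R :=
  2 * x ^+ 3 * (2 - 9 * (1 - x) ^+ 2).

Lemma zmax_bounds {R : realType} {x : R} :
  32 / 55 <= x <= 7 / 12 -> 1 / 6 <= zmax x <= 7 / 40.
Proof.
move=> /andP[x1 x2]; rewrite /zmax.
have x3l : (32 / 55) ^+ 3 <= x ^+ 3 by rewrite lerXn2r ?nnegrE; lra.
have x3u : x ^+ 3 <= (7 / 12) ^+ 3 by rewrite lerXn2r ?nnegrE; lra.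
have yl : 426 / 1000 <= 2 - 9 * (1 - x) ^+ 2 by nra.
have yu : 2 - 9 * (1 - x) ^+ 2 <= 438 / 1000 by nra.
move: (x ^+ 3) (2 - _) x3l x3u yl yu => s t; nra.
Qed.

(** At a root of [quintic_x], [3 * zmax x] is a quartic in [x]; substituting it
    keeps the cofactor of [quintic_x x] in [quintic_z (zmax x)] of degree 15. *)
Lemma quintic_z_zmax {R : realType} {x : R} :
  quintic_x x = 0 -> quintic_z (zmax x) = 0.
Proof.
move=> Qx.
have -> : zmax x =
    (-5 + 42 * x - 114 * x ^+ 2 + 126 * x ^+ 3 - 45 * x ^+ 4 - quintic_x x) / 3.
  by rewrite /zmax /quintic_x; field.
rewrite Qx subr0.
transitivity (quintic_x x * (
    18147939%:R - 307094130%:R * x + 2396136510%:R * x ^+ 2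
    - 11927128752%:R * x ^+ 3 + 45313873065%:R * x ^+ 4
    - 146443736322%:R * x ^+ 5 + 407287493136%:R * x ^+ 6
    - 925374573288%:R * x ^+ 7 + 1631687533173%:R * x ^+ 8
    - 2165568866262%:R * x ^+ 9 + 2122410604374%:R * x ^+ 10
    - 1506381980400%:R * x ^+ 11 + 751269765375%:R * x ^+ 12
    - 249408213750%:R * x ^+ 13 + 49453537500%:R * x ^+ 14
    - 4428675000%:R * x ^+ 15)); last by rewrite Qx mul0r.
by rewrite /quintic_z /quintic_x; field.
Qed.

(** Dividing [quintic_z t] by [t - z] leaves a quartic in [t] that is negative
    on the whole interval, although [quintic_z] itself is not monotone there. *)
Lemma quintic_z_uniq {R : realType} {z t : R} :
  1 / 6 <= z <= 7 / 40 -> 0 < t < 1 / 5 ->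
  quintic_z z = 0 -> quintic_z t = 0 -> t = z.
Proof.
move=> /andP[z0 z1] /andP[t0 t1] Qz Qt.
(* The coefficients of the quotient, by Horner's scheme. *)
pose b3 := -821583%:R + 314928%:R * z.
pose b2 := 14567472%:R + z * b3.
pose b1 := -4557600%:R + z * b2.
pose b0 := 168192%:R + z * b1.
have : (t - z) * (b0 + b1 * t + b2 * t ^+ 2
                  + (b3 + 314928%:R * t) * t ^+ 3) = 0.
  transitivity (quintic_z t - quintic_z z); last by rewrite Qt Qz subrr.
  rewrite /quintic_z /b0 /b1 /b2 /b3; ring.
have hb3 : -821583%:R <= b3 <= -766000%:R by rewrite /b3; lra.
have hb2 : 14420000%:R <= b2 <= 14450000%:R by rewrite /b2; clearbody b3; nra.
have hb1 : b1 + b2 / 5 <= 865000%:R.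
  by rewrite /b1; clearbody b2 b3; nra.
have hb0 : b0 <= -180000%:R.
  have -> : b0 = 168192%:R - 4557600%:R * z + z ^+ 2 * b2.
    by rewrite /b0 /b1; ring.
  have : z ^+ 2 * b2 <= z ^+ 2 * 14450000%:R.
    by rewrite ler_wpM2l ?sqr_ge0; lra.
  have : 0 <= (z - 1 / 6) * (7 / 40 - z) by rewrite mulr_ge0 //; lra.
  lra.
clearbody b0 b1 b2 b3.
have s3 : (b3 + 314928%:R * t) * t ^+ 3 <= 0.
  by rewrite mulr_le0_ge0 ?exprn_ge0; lra.
have s2 : b1 * t + b2 * t ^+ 2 <= t * 865000%:R.
  have : 0 <= t * (865000%:R - (b1 + b2 / 5)) by rewrite mulr_ge0; lra.
  have : 0 <= b2 * (t * (1 / 5 - t)) by rewrite !mulr_ge0; lra.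
  lra.
move/eqP; rewrite mulf_eq0 => /orP[|/eqP ?]; first by rewrite subr_eq0 => /eqP.
lra.
Qed.

(** * The bound on the gap *)

(** Concave in [b c] when [a] and [b + c] are fixed: the only quadratic term
    comes from the product of [6 b c] and [f = a^2 + (1 - a)^2 - 2 b c]. *)
Definition slack {R : realType} (z a b c : R) : R :=
  let f := a ^+ 2 + b ^+ 2 + c ^+ 2 in
  z * f - 2 * a ^+ 2 * (1 - (3 - 2 * a + 6 * (b * c)) * f).

Lemma slackE {R : realType} (z : R) {a b c : R} : a + b + c = 1 ->
  slack z a b c = 2 * (a ^+ 2 + b ^+ 2 + c ^+ 2) * (z / 2 - gap a b c).
Proof. by move=> /sqsum_gt0 f0; rewrite /slack /gap; field; rewrite gt_eqF. Qed.

(** The quotient of [z q(a) - N(a)] by [(a - x)^2] at the critical [x]. *)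
Definition slack_quot {R : realType} (x z a : R) : R :=
  a ^+ 2 * (9 * (1 - a) ^+ 2 + 18 * (1 - a) * (1 - x)
            + (27 * (1 - x) ^+ 2 - 4))
  + 4 * a * (1 - x) * (2 - 9 * (1 - x) ^+ 2)
  + (1 - x) * (8 - 12 * (1 - x) - 36 * (1 - x) ^+ 2 + 45 * (1 - x) ^+ 3)
  + 3 * z.

(** The remainder of the division by [(a - x)^2] is [- x (2 a - x) quintic_x x]:
    the quintic expresses both that the value [zmax x] is attained at [x] and
    that [x] is critical. *)
Lemma slack_equal {R : realType} {x : R} (a : R) : quintic_x x = 0 ->
  2 * slack (zmax x) a ((1 - a) / 2) ((1 - a) / 2) =
  (a - x) ^+ 2 * slack_quot x (zmax x) a.
Proof.
move=> Qx; transitivity ((a - x) ^+ 2 * slack_quot x (zmax x) a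
    - x * (2 * a - x) * quintic_x x); last by rewrite Qx mulr0 subr0.
by rewrite /slack /slack_quot /zmax /quintic_x; field.
Qed.

(** Concavity in [m = b c], without division: [m] divides the interval from 0 to
    [(1 - a)^2 / 4] in the ratio [4 b c] to [(b - c)^2]. *)
Lemma slack_concave {R : realType} (z : R) {a b c : R} : a + b + c = 1 ->
  (1 - a) ^+ 2 * slack z a b c =
    (b - c) ^+ 2 * slack z a (1 - a) 0
    + 4 * (b * c) * slack z a ((1 - a) / 2) ((1 - a) / 2)
    + 6 * a ^+ 2 * (b * c) * (1 - a) ^+ 2 * (b - c) ^+ 2.
Proof.
move=> abc; have -> : a = 1 - b - c by rewrite -abc; ring.
by rewrite /slack; field.
Qed.

(** Near the critical point [1 - x] is about 0.418, and then each of the terms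
    of [slack_quot] is nonnegative except possibly for the one free of [a] and
    [z], which is smaller in absolute value than [3 z >= 1/2]. *)
Lemma slack_quot_gt0 {R : realType} {x z a : R} :
  32 / 55 <= x <= 7 / 12 -> 1 / 6 <= z -> 0 <= a <= 1 ->
  0 < slack_quot x z a.
Proof.
rewrite /slack_quot => /andP[x1 x2] z0 /andP[a0 a1].
have y1 : 5 / 12 <= 1 - x by lra.
have y2 : 1 - x <= 23 / 55 by lra.
set y := 1 - x in y1 y2 *; clearbody y.
have yy1 : 0 <= (y - 5 / 12) * (y + 5 / 12) by rewrite mulr_ge0 //; lra.
have yy2 : 0 <= (23 / 55 - y) * (y + 23 / 55) by rewrite mulr_ge0 //; lra.
have e0 : 0 <= 27 * y ^+ 2 - 4 by lra.
have e1 : 0 <= a ^+ 2 *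
    (9 * (1 - a) ^+ 2 + 18 * (1 - a) * y + (27 * y ^+ 2 - 4)).
  have ay : 0 <= (1 - a) * y by rewrite mulr_ge0; lra.
  by have a1sq := sqr_ge0 (1 - a); apply: mulr_ge0; [exact: sqr_ge0 | lra].
have e2' : 0 <= 2 - 9 * y ^+ 2 by lra.
have y0 : 0 <= y by lra.
have e2 := mulr_ge0 (mulr_ge0 a0 y0) e2'.
have e3 : 0 <= 1 / 10 + (8 - 12 * y - 36 * y ^+ 2 + 45 * y ^+ 3) by nra.
have e4 := mulr_ge0 y0 e3.
lra.
Qed.

(** With [h = a (1 - a)] this is [z (1 - 2 h) - 4 h^2 (2 a - 1)], and the AM-GM
    inequality bounds [2 a - 1], the square root of [1 - 4 h] when [a >= 1/2],
    by [5/4 - 4 h]; what is left is a cubic in [h] on [0, 1/4]. *)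
Lemma slack_two_gt0 {R : realType} {z a : R} :
  1 / 6 <= z -> 0 <= a <= 1 -> 0 < slack z a (1 - a) 0.
Proof.
move=> z0 /andP[a0 a1].
pose h := a * (1 - a).
have h0 : 0 <= h by rewrite mulr_ge0; lra.
have h1 : h <= 1 / 4 by have := sqr_ge0 (a - 1 / 2); rewrite /h; lra.
have -> : slack z a (1 - a) 0 = z * (1 - 2 * h) - 4 * h ^+ 2 * (2 * a - 1).
  by rewrite /slack /h; ring.
have : 2 * a - 1 <= 5 / 4 - 4 * h.
  by have := sqr_ge0 (2 * a - 3 / 2); rewrite /h; lra.
clearbody h => le_h.
have := ler_wpM2l (sqr_ge0 h) le_h.
(* 238/1000 is close to the minimum of the cubic. *)
have := mulr_ge0 h0 (sqr_ge0 (h - 238 / 1000)).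
have := sqr_ge0 (h - 238 / 1000).
have : 0 <= (z - 1 / 6) * (1 - 2 * h) by rewrite mulr_ge0; lra.
lra.
Qed.

Lemma slack_max {R : realType} {x a b c : R} :
  32 / 55 <= x <= 7 / 12 -> quintic_x x = 0 ->
  0 <= a -> 0 <= b -> 0 <= c -> a + b + c = 1 ->
  0 <= slack (zmax x) a b c /\
  (slack (zmax x) a b c = 0 -> a = x /\ b = c).
Proof.
move=> xI Qx a0 b0 c0 abc.
have /andP[z0 _] := zmax_bounds xI.
have aI : 0 <= a <= 1 by lra.
have conc := slack_concave (zmax x) abc.
have P0 := slack_two_gt0 z0 aI.
have Rgt0 := slack_quot_gt0 xI z0 aI.
have P1E := slack_equal a Qx.
have P1 : 0 <= slack (zmax x) a ((1 - a) / 2) ((1 - a) / 2).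
  by have := mulr_ge0 (sqr_ge0 (a - x)) (ltW Rgt0); lra.
have bc0 : 0 <= b * c by rewrite mulr_ge0.
have t0 : 0 <= (b - c) ^+ 2 * slack (zmax x) a (1 - a) 0.
  by rewrite mulr_ge0 ?sqr_ge0 // ltW.
have t1 : 0 <= 4 * (b * c) * slack (zmax x) a ((1 - a) / 2) ((1 - a) / 2).
  by apply: mulr_ge0 => //; lra.
have t2 : 0 <= 6 * a ^+ 2 * (b * c) * (1 - a) ^+ 2 * (b - c) ^+ 2.
  have := sqr_ge0 a; have := sqr_ge0 (1 - a); have := sqr_ge0 (b - c).
  by move=> s1 s2 s3; do 3![apply: mulr_ge0 => //]; lra.
(* At a = 1 the factor (1 - a)^2 vanishes, and only two colors remain. *)
have [a1|a1] := eqVneq a 1.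
  have bE : b = 1 - a by lra.
  have cE : c = 0 by lra.
  rewrite bE cE; split; first exact: ltW.
  by move=> P00; rewrite P00 ltxx in P0.
have s0 : 0 < (1 - a) ^+ 2 by rewrite exprn_even_gt0 //= subr_eq0 eq_sym.
split; first by rewrite -(pmulr_rge0 _ s0) conc !addr_ge0.
move=> P; rewrite P mulr0 in conc.
have bc : b = c.
  have /eqP : (b - c) ^+ 2 * slack (zmax x) a (1 - a) 0 = 0 by lra.
  by rewrite mulf_eq0 sqrf_eq0 subr_eq0 (gt_eqF P0) orbF => /eqP.
split=> //.
have /eqP : 4 * (b * c) * slack (zmax x) a ((1 - a) / 2) ((1 - a) / 2) = 0.
  by lra.
have -> : 4 * (b * c) = (1 - a) ^+ 2.
  have -> : a = 1 - b - c by lra.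
  by rewrite bc; ring.
rewrite mulf_eq0 (gt_eqF s0) /= => /eqP P10.
move/esym/eqP: P1E; rewrite P10 mulr0 mulf_eq0 (gt_eqF Rgt0) orbF.
by rewrite sqrf_eq0 subr_eq0 => /eqP.
Qed.

Lemma gap_max {R : realType} {x a b c : R} :
  32 / 55 <= x <= 7 / 12 -> quintic_x x = 0 ->
  0 <= a -> 0 <= b -> 0 <= c -> a + b + c = 1 ->
  gap a b c <= zmax x / 2 /\ (gap a b c = zmax x / 2 -> a = x /\ b = c).
Proof.
move=> xI Qx a0 b0 c0 abc.
have [P Peq] := slack_max xI Qx a0 b0 c0 abc.
have PE := slackE (zmax x) abc; have f0 := sqsum_gt0 abc.
split; last by move=> g; apply: Peq; rewrite PE g subrr mulr0.
rewrite -subr_ge0 -(@pmulr_rge0 _ (2 * (a ^+ 2 + b ^+ 2 + c ^+ 2))).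
  by rewrite -PE.
by rewrite mulr_gt0.
Qed.

Lemma gap_argmax {R : realType} {x : R} :
  quintic_x x = 0 -> gap x ((1 - x) / 2) ((1 - x) / 2) = zmax x / 2.
Proof.
move=> Qx.
have abc : x + (1 - x) / 2 + (1 - x) / 2 = 1 by field.
have f0 := sqsum_gt0 abc.
have := slack_equal x Qx; rewrite subrr expr0n mul0r (slackE _ abc) => /eqP.
by rewrite !mulf_eq0 !pnatr_eq0 (gt_eqF f0) subr_eq0 /= => /eqP.
Qed.

(** * The maximum *)

Theorem mainTheorem3 (R : realType) :
  exists x2 z : R,
    [/\ unique (fun x : R => 1 / 2 <= x <= 3 / 5 /\ quintic_x x = 0) x2,
        unique (fun t : R => 0 < t < 1 / 5 /\ quintic_z t = 0) z &
        let pmax := triple x2 ((1 - x2) / 2) ((1 - x2) / 2) in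
        [/\ ordered_distr3 pmax,
            discrepancy pmax = z / 2 &
            forall p : {ffun 'I_3 -> R}, ordered_distr3 p ->
              discrepancy p <= discrepancy pmax /\
              (discrepancy p = discrepancy pmax -> p = pmax)]].
Proof.
have [x xI Qx] := quintic_x_root R.
have zI := zmax_bounds xI.
have /andP[x_ge x_le] := xI; have /andP[z_ge z_le] := zI.
set y := (1 - x) / 2.
have y0 : 0 <= y by rewrite /y; lra.
have [pm0 pm1 pm2] : [/\ triple x y y color0 = x, triple x y y color1 = y
                      & triple x y y color2 = y] by rewrite /triple !ffunE.
have pmax_ok : ordered_distr3 (triple x y y).
  split; last by rewrite pm0 pm1 pm2 lexx /= /y; lra.
  split; last by rewrite sum_I3 pm0 pm1 pm2 /y; field.
  by case=> [[|[|[|?]]]] ?; rewrite ffunE //=; lra.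
have Dmax : discrepancy (triple x y y) = zmax x / 2.
  rewrite discrepancy3 // pm0 pm1 pm2 gap_argmax // max_l //.
  by have := @gap_least R x y y y0 _ (lexx y) _; rewrite /y; lra.
exists x, (zmax x); split.
- split; first by split=> //; lra.
  move=> t [/andP[t_ge t_le] Qt].
  case: (ltrgtP x t) => // xt; have := quintic_x_decr _ xt _;
    by rewrite Qx Qt ltxx => h; exfalso; apply: notF; apply: h; lra.
- split; first by split; [lra | exact: quintic_z_zmax].
  by move=> t [tI Zt]; apply/esym/quintic_z_uniq => //; exact: quintic_z_zmax.
split=> // p p_ok; rewrite Dmax discrepancy3 //.
have [[p0 p1] /andP[p21 p10]] := p_ok; rewrite sum_I3 in p1.
have [g_le g_eq] := gap_max xI Qx (p0 color0) (p0 color1) (p0 color2) p1.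
have g2 := gap_least (p0 color2) p1 p21 p10.
split; first by rewrite ge_max g_le /=; lra.
case: lerP => _ gE; first by exfalso; lra.
have [pa pbc] := g_eq gE.
apply/ffunP; case=> [[|[|[|?]]]] lt_i //; rewrite ffunE /=.
- by rewrite -pa; congr (p _); apply: val_inj.
- transitivity (p color1); first by congr (p _); apply: val_inj.
  rewrite /y; lra.
- transitivity (p color2); first by congr (p _); apply: val_inj.
  rewrite /y; lra.
Qed.
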